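(* Let $(\mathbb{Q},\gamma)$ be a supermixed quiver setting. The $\mathrm{DGL}_\gamma$-orbits in $\mathrm{DRep}(\mathbb{Q},\gamma)$ classify the $\epsilon$-mixed module structures on $(\mathbb{C}^{\bar\gamma},\langle\,,\rangle)$ up to $\epsilon$-isomorphism. That is, sending a point $W\in\mathrm{Rep}(\mathbb{Q},\gamma)$ to the $\mathbb{C}Q$-module structure it defines on $\mathbb{C}^{\bar\gamma}$ identifies $\mathrm{DRep}(\mathbb{Q},\gamma)$ with the set of $\mathbb{C}Q$-module structures on $\mathbb{C}^{\bar\gamma}$ (in which each vertex $v$ acts as the projection onto $\mathbb{C}^{\bar\gamma_v}$) that are $\epsilon$-mixed for the form $\langle\,,\rangle$, and two points of $\mathrm{DRep}(\mathbb{Q},\gamma)$ give $\epsilon$-isomorphic $\epsilon$-mixed modules if and only if they lie in the same $\mathrm{DGL}_\gamma$-orbit.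
   Context: Everything is over $\mathbb{C}$. A quiver $Q$ has finite vertex set $Q_0$, finite arrow set $Q_1$, head and tail maps $h,t:Q_1\to Q_0$. Its path algebra $\mathbb{C}Q$ has as basis the paths $a_1\cdots a_k$ with $t(a_i)=h(a_{i+1})$, and the vertices (paths of length zero), with multiplication by concatenation. A supermixed quiver $\mathbb{Q}=(Q,\phi,\epsilon,\sigma)$ consists of a quiver $Q$, involutions $\phi$ on $Q_0$ and on $Q_1$, and sign maps $\epsilon:Q_0\to\{\pm1\}$, $\sigma:Q_1\to\{\pm1\}$ such that $h(\phi(a))=\phi(t(a))$; $h(a)=h(\phi(a))\Rightarrow a=\phi(a)$; $\epsilon_v\epsilon_{\phi(v)}=1=\sigma_a\sigma_{\phi(a)}$. A supermixed quiver setting $(\mathbb{Q},\gamma)$ also has an invertible complex square matrix $\gamma_v$ for each $v\in Q_0$ with $\gamma_v=\epsilon_v\gamma_{\phi(v)}^{\top}$; $\bar\gamma_v$ is the size of $\gamma_v$. Put $S_\gamma=\bigoplus_{v}\mathrm{Mat}_{\bar\gamma_v\times\bar\gamma_v}(\mathbb{C})$, $\mathbb{C}^{\bar\gamma}=\bigoplus_v\mathbb{C}^{\bar\gamma_v}$, $\mathrm{Rep}(\mathbb{Q},\gamma)=\bigoplus_{a}\mathrm{Mat}_{\bar\gamma_{h(a)}\times\bar\gamma_{t(a)}}(\mathbb{C})$. A point $W$ of $\mathrm{Rep}(\mathbb{Q},\gamma)$ makes $\mathbb{C}^{\bar\gamma}$ a left $\mathbb{C}Q$-module: $v$ acts as the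 projection onto $\mathbb{C}^{\bar\gamma_v}$, and $a$ acts as $W_a:\mathbb{C}^{\bar\gamma_{t(a)}}\to\mathbb{C}^{\bar\gamma_{h(a)}}$ and as zero on the other summands. Involutions: $$(s^* )_v=\gamma_{\phi(v)}^{-1}s_{\phi(v)}^{\top}\gamma_{\phi(v)}\ (s\in S_\gamma),\qquad (m^* )_a=\sigma_a\epsilon_{t(a)}\gamma_{\phi(h(a))}^{-1}m_{\phi(a)}^{\top}\gamma_{\phi(t(a))}\ (m\in\mathrm{Rep}(\mathbb{Q},\gamma)).$$ Set $\mathrm{DGL}_\gamma=\{g\in S_\gamma: gg^*=1\}$ and $\mathrm{DRep}(\mathbb{Q},\gamma)=\{m: m^*=m\}$, with action $m\mapsto gmg^*$, i.e. $m_a\mapsto g_{h(a)}m_ag_{t(a)}^{-1}$. The form on $\mathbb{C}^{\bar\gamma}$ is $\langle x,y\rangle=\sum_v x_v^{\top}\gamma_v y_{\phi(v)}$ (column vectors). Write $\epsilon=\sum_v\epsilon_v v\in\mathbb{C}Q$, and let $*$ be the anti-automorphism of $\mathbb{C}Q$ ($(xy)^*=y^*x^*$) with $v^*=\phi(v)$, $a^*=\sigma_a\epsilon_{h(a)}\phi(a)$. An $\epsilon$-mixed module is a finite dimensional left $\mathbb{C}Q$-module $V$ with a nondegenerate bilinear form such that $\langle v,w\rangle=\langle w,\epsilon v\rangle$ and $\langle xv,w\rangle=\langle v,x^*w\rangle$ for all $v,w\in V$, $x\in\mathbb{C}Q$. Two $\epsilon$-mixed modules are $\epsilon$-isomorphic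 if there is a module isomorphism between them preserving the bilinear forms. *)

(* Defs.v *)
From HB Require Import structures.
From mathcomp Require Import all_boot all_order all_algebra.
From mathcomp Require Import finmap.
From mathcomp.multinomials Require Import monalg.
From mathcomp Require Import classical_sets functions reals complex.

Set Implicit Arguments.
Unset Strict Implicit.
Unset Printing Implicit Defensive.

Import GRing.Theory.
Local Open Scope ring_scope.

Record quiver := Quiver {
  Q0 : finType;
  Q1 : finType;
  hd : Q1 -> Q0;
  tl : Q1 -> Q0
}.

Arguments hd {q} _.
Arguments tl {q} _.

Section Paths.
Variable Q : quiver.

Fixpoint composable (v : Q0 Q) (s : seq (Q1 Q)) : bool :=
  if s is a :: s' then (hd a == v) && composable (tl a) s' else true.

(* The path a_1 ... a_k is encoded as (h(a_1), [:: a_1; ...; a_k]), and the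
   path of length zero at v as (v, [::]). *)
Record qpath := QPath {
  pval :> Q0 Q * seq (Q1 Q);
  _ : composable pval.1 pval.2
}.

HB.instance Definition _ := [isSub for pval].
HB.instance Definition _ := [Choice of qpath by <:].

Definition phead (p : qpath) : Q0 Q := p.1.
Definition ptail (p : qpath) : Q0 Q := last p.1 (map tl p.2).

Definition pvertex (v : Q0 Q) : qpath := @QPath (v, [::]) isT.

Lemma arrow_composable (a : Q1 Q) : composable (hd a) [:: a].
Proof. by rewrite /= eqxx. Qed.

Definition parrow (a : Q1 Q) : qpath := @QPath (hd a, [:: a]) (arrow_composable a).

Lemma composable_cat v s1 s2 :
  composable v (s1 ++ s2) =
  composable v s1 && composable (last v (map tl s1)) s2.
Proof. by elim: s1 v => //= a s1 IH v; rewrite IH andbA. Qed.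

(* Only used when [ptail p = phead q], in which case the concatenation is a
   path and the default value is irrelevant (see [pcatE]). *)
Definition pcat (p q : qpath) : qpath := insubd p (p.1, p.2 ++ q.2).

Lemma pcatE p q : ptail p = phead q -> pcat p q = (p.1, p.2 ++ q.2) :> _ * _.
Proof.
move=> e; rewrite val_insubd /= composable_cat (valP p) /=.
by rewrite -[last _ _]/(ptail p) e (valP q).
Qed.

Lemma ptail_cat p q : ptail p = phead q -> ptail (pcat p q) = ptail q.
Proof.
by move=> e; rewrite {1}/ptail pcatE //= map_cat last_cat -[last p.1 _]/(ptail p) e.
Qed.

Lemma phead_cat p q : ptail p = phead q -> phead (pcat p q) = phead p.
Proof. by move=> e; rewrite /phead pcatE. Qed.

End Paths.

Section LinearExtension.
Variables (F : fieldType) (K : choiceType) (V : lmodType F).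

Definition linext (f : K -> V) (x : {malg F[K]}) : V :=
  \sum_(p <- msupp x) x@_p *: f p.

Lemma linextEw f (d : {fset K}) x : (msupp x `<=` d)%fset ->
  linext f x = \sum_(p <- d) x@_p *: f p.
Proof.
move=> le; rewrite /linext (big_fset_incl _ le) //= => p _ /mcoeff_outdom ->.
by rewrite scale0r.
Qed.

Lemma linext_is_linear f : linear (linext f).
Proof.
move=> c x y; pose d := (msupp (c *: x + y) `|` (msupp x `|` msupp y))%fset.
rewrite !(@linextEw _ d) ?fsubsetUl //.
- rewrite scaler_sumr -big_split /=; apply: eq_bigr => p _.
  by rewrite mcoeffD mcoeffZ scalerDl scalerA.
- by rewrite /d fsetUA fsubsetUr.
- by rewrite /d fsetUCA fsubsetUl.
Qed.

HB.instance Definition _ f :=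
  GRing.isLinear.Build F {malg F[K]} V *:%R (linext f) (linext_is_linear f).

Lemma linextU f p : linext f << p >> = f p.
Proof.
by rewrite (linextEw _ msuppU_le) big_seq_fset1 mcoeffUU scale1r.
Qed.

Lemma linext_fun_linear c f g x :
  linext (fun p => c *: f p + g p) x = c *: linext f x + linext g x.
Proof.
rewrite /linext scaler_sumr -big_split /=; apply: eq_bigr => p _.
by rewrite scalerDr !scalerA [c * _]mulrC.
Qed.

Lemma linextP (f g : {malg F[K]} -> V) : linear f -> linear g ->
  (forall p, f << p >> = g << p >>) -> f =1 g.
Proof.
move=> linf ling e x.
pose f' : {linear {malg F[K]} -> V} :=
  HB.pack f (GRing.isLinear.Build F _ _ _ f linf).
pose g' : {linear {malg F[K]} -> V} :=
  HB.pack g (GRing.isLinear.Build F _ _ _ g ling).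
rewrite -[f]/(f' : _ -> _) -[g]/(g' : _ -> _).
rewrite [x]monalgE !linear_sum; apply: eq_bigr => p _.
suff -> : << x@_p *g p >> = x@_p *: << p >> :> {malg F[K]}.
  by rewrite !linearZ /= e.
by apply/malgP => q; rewrite mcoeffZ !mcoeffU mulrnAr mulr1.
Qed.

End LinearExtension.

Definition path_algebra (F : fieldType) (Q : quiver) : Type :=
  {malg F[qpath Q]}.

HB.instance Definition _ (F : fieldType) (Q : quiver) :=
  GRing.Lmodule.copy (path_algebra F Q) {malg F[qpath Q]}.

(* The basis vector given by a path; locked because unification otherwise
   unfolds the finitely supported function. *)
HB.lock Definition pbase (F : fieldType) (Q : quiver) (p : qpath Q) :
  path_algebra F Q := << p >>.

Definition pmul (F : fieldType) (Q : quiver) (p q : qpath Q) :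
    path_algebra F Q :=
  if ptail p == phead q then pbase F (pcat p q) else 0.

HB.lock Definition pamul (F : fieldType) (Q : quiver)
    (x y : path_algebra F Q) : path_algebra F Q :=
  linext (fun p => linext (pmul F p) y : path_algebra F Q) x.

Section PathAlgebra.
Variables (F : fieldType) (Q : quiver).
Local Notation CQ := (path_algebra F Q).
Local Notation pbase := (@pbase F Q).
Local Notation pmul := (@pmul F Q).
Local Notation pamul := (@pamul F Q).

Definition vertex (v : Q0 Q) : CQ := pbase (pvertex v).
Definition arrow (a : Q1 Q) : CQ := pbase (parrow a).

Definition paone : CQ := \sum_v vertex v.

Lemma pa_linearP (V : lmodType F) (f g : CQ -> V) : linear f -> linear g ->
  (forall p, f (pbase p) = g (pbase p)) -> f =1 g.
Proof. by move=> linf ling; rewrite unlock; exact: linextP. Qed.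

Lemma linext_pbase (V : lmodType F) (f : qpath Q -> V) p :
  linext f (pbase p) = f p.
Proof. by rewrite unlock linextU. Qed.

Fact pamul_linl y : linear (pamul^~ y).
Proof. by rewrite pamul.unlock; exact: linext_is_linear. Qed.

Fact pamul_linr x : linear (pamul x).
Proof.
move=> c y y'; rewrite pamul.unlock.
apply: etrans (linext_fun_linear _ _ _ _).
by apply: eq_bigr => p _; rewrite linext_is_linear.
Qed.

HB.instance Definition _ x := GRing.isLinear.Build F CQ CQ *:%R
  (pamul x) (pamul_linr x).

Fact pamulUU p q : pamul (pbase p) (pbase q) = pmul p q.
Proof. by rewrite pamul.unlock !linext_pbase. Qed.

Fact pamul0l y : pamul 0 y = 0.
Proof. by have := pamul_linl y (-1) 0 0; rewrite !scaleN1r !addNr. Qed.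

Lemma pamulA : associative pamul.
Proof.
move=> x y z; move: x; apply: pa_linearP => [c u v|c u v|p].
- by rewrite pamul_linl.
- by rewrite 2!pamul_linl.
move: y; apply: pa_linearP => [c u v|c u v|q].
- by rewrite pamul_linl pamul_linr.
- by rewrite pamul_linr pamul_linl.
move: z; apply: pa_linearP => [c u v|c u v|r].
- by rewrite 2!pamul_linr.
- by rewrite pamul_linr.
rewrite !pamulUU /Defs.pmul.
case: eqP => [eqr|nqr]; case: eqP => [epq|npq].
- rewrite !pamulUU /Defs.pmul phead_cat ?ptail_cat ?epq ?eqr ?eqxx //.
  congr (pbase _); apply: val_inj.
  by rewrite /= !pcatE ?phead_cat ?ptail_cat //= catA.
- by rewrite pamulUU /Defs.pmul phead_cat // pamul0l; case: eqP npq.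
- by rewrite linear0 pamulUU /Defs.pmul ptail_cat //; case: eqP nqr.
- by rewrite linear0 pamul0l.
Qed.

Lemma pamul1 : left_id paone pamul.
Proof.
apply: pa_linearP => // [|p]; first exact: pamul_linr.
rewrite pamul.unlock linear_sum (bigD1 (phead p)) //= big1 => [|v nv].
  rewrite addr0 !linext_pbase /Defs.pmul eqxx; congr (pbase _); apply: val_inj.
  by rewrite /= pcatE //= -surjective_pairing.
by rewrite !linext_pbase /Defs.pmul (negPf nv).
Qed.

Lemma pa1mul : right_id paone pamul.
Proof.
apply: pa_linearP => // [|p]; first exact: pamul_linl.
rewrite linear_sum (bigD1 (ptail p)) //= big1 => [|v nv].
  rewrite addr0 pamulUU /Defs.pmul eqxx; congr (pbase _); apply: val_inj.
  by rewrite /= pcatE //= cats0 -surjective_pairing.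
by rewrite pamulUU /Defs.pmul eq_sym (negPf nv).
Qed.

Fact pamulDl : left_distributive pamul +%R.
Proof. by move=> x y z; have := pamul_linl z 1 x y; rewrite !scale1r. Qed.

Fact pamulDr : right_distributive pamul +%R.
Proof. by move=> x y z; exact: linearD. Qed.

(* Only a [pzRingType]: the path algebra is zero if Q has no vertices. *)
HB.instance Definition _ := GRing.Zmodule_isPzRing.Build CQ
  pamulA pamul1 pa1mul
  pamulDl pamulDr.

Lemma paE (x y : CQ) : x * y = pamul x y. Proof. by []. Qed.

Lemma pascalerAl c (x y : CQ) : c *: (x * y) = (c *: x) * y.
Proof. by have := pamul_linl y c x 0; rewrite !paE pamul0l !addr0. Qed.

Lemma pascalerAr c (x y : CQ) : c *: (x * y) = x * (c *: y).
Proof. by rewrite !paE linearZ. Qed.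

End PathAlgebra.

Arguments vertex {F Q} _.
Arguments arrow {F Q} _.

Section LeftModules.
Variables (F : fieldType) (Q : quiver).

Record is_left_module (V : vectType F)
    (act : path_algebra F Q -> V -> V) : Prop := IsLeftModule {
  act_linearl : forall v, linear (act^~ v);
  act_linearr : forall x, linear (act x);
  act_one : forall v, act 1 v = v;
  act_mul : forall x y v, act (x * y) v = act x (act y v)
}.

End LeftModules.

Record supermixed_quiver := SupermixedQuiver {
  smq_quiver :> quiver;
  phi0 : Q0 smq_quiver -> Q0 smq_quiver;
  phi1 : Q1 smq_quiver -> Q1 smq_quiver;
  eps : Q0 smq_quiver -> int;
  sgm : Q1 smq_quiver -> int;
  phi0K : involutive phi0;
  phi1K : involutive phi1;
  eps_sign : forall v, eps v = 1 \/ eps v = -1;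
  sgm_sign : forall a, sgm a = 1 \/ sgm a = -1;
  hd_phi : forall a, hd (phi1 a) = phi0 (tl a);
  phi1_fix : forall a, hd a = hd (phi1 a) -> a = phi1 a;
  eps_phi : forall v, eps v * eps (phi0 v) = 1;
  sgm_phi : forall a, sgm a * sgm (phi1 a) = 1
}.

Lemma tl_phi (Q : supermixed_quiver) (a : Q1 Q) : tl (phi1 a) = phi0 (hd a).
Proof. by rewrite -{2}(phi1K a) hd_phi phi0K. Qed.

Section MixedModules.
Variables (F : fieldType) (Q : supermixed_quiver).
Local Notation CQ := (path_algebra F Q).

Definition epsQ : CQ := \sum_v (eps v)%:~R *: vertex v.

Definition star_arrow (a : Q1 Q) : CQ :=
  (sgm a * eps (hd a))%:~R *: arrow (phi1 a).

(* A path p = a_1 ... a_k with head v equals v a_1 ... a_k in the path algebra,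
   hence p^* = a_k^* ... a_1^* v^*; this also covers k = 0. *)
Definition star_path (p : qpath Q) : CQ :=
  (\prod_(a <- rev p.2) star_arrow a) * vertex (phi0 p.1).

Definition star : CQ -> CQ := linext star_path.

HB.instance Definition _ := GRing.Linear.on star.

Lemma star_vertex v : star (vertex v) = vertex (phi0 v).
Proof. by rewrite /star linext_pbase /star_path big_nil mul1r. Qed.

Lemma arrow_vertex (a : Q1 Q) v :
  arrow a * vertex v = (if tl a == v then arrow a else 0) :> CQ.
Proof.
rewrite paE pamulUU /Defs.pmul [ptail _]/= [phead _]/=; case: eqP => // e.
by congr (pbase _); apply: val_inj; rewrite /= pcatE.
Qed.

Lemma vertex_vertex (u v : Q0 Q) :
  vertex u * vertex v = (if u == v then vertex u else 0) :> CQ.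
Proof.
rewrite paE pamulUU /Defs.pmul [ptail _]/= [phead _]/=; case: eqP => // e.
by congr (pbase _); apply: val_inj; rewrite /= pcatE.
Qed.

Lemma vertex_arrow (a : Q1 Q) v :
  vertex v * arrow a = (if v == hd a then arrow a else 0) :> CQ.
Proof.
rewrite paE pamulUU /Defs.pmul [ptail _]/= [phead _]/=; case: eqP => // e.
by congr (pbase _); apply: val_inj; rewrite /= pcatE //= (e : v = hd a).
Qed.

Lemma star_arrowE a : star (arrow a) = star_arrow a.
Proof.
rewrite /star linext_pbase /star_path /= /rev /= big_seq1 /star_arrow.
by rewrite -pascalerAl arrow_vertex tl_phi eqxx.
Qed.

Lemma starM x y : star (x * y) = star y * star x.
Proof.
rewrite !paE; move: x; apply: pa_linearP => [c u v|c u v|p].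
- by rewrite pamul_linl linearP.
- by rewrite linearP pamul_linr.
move: y; apply: pa_linearP => [c u v|c u v|q].
- by rewrite pamul_linr linearP.
- by rewrite linearP pamul_linl.
rewrite pamulUU -paE /Defs.pmul /star (fun_if (linext _)) linear0 !linext_pbase.
have vs v (s : seq (Q1 Q)) : composable v s ->
    vertex (phi0 (last v (map tl s))) * \prod_(a <- rev s) star_arrow a
      * vertex (phi0 v) = \prod_(a <- rev s) star_arrow a * vertex (phi0 v).
  elim: s v => [|a s IH] v /=; first by rewrite big_nil mulr1 mul1r
    vertex_vertex eqxx.
  case/andP => /eqP <- /IH {}IH; rewrite rev_cons -cats1 big_cat big_seq1 /=.
  have -> : star_arrow a = vertex (phi0 (tl a)) * star_arrow a.
    by rewrite /star_arrow -pascalerAr vertex_arrow hd_phi eqxx.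
  by rewrite !mulrA IH.
have -> : star_path q * star_path p =
    \prod_(a <- rev q.2) star_arrow a *
    (if ptail p == phead q then star_path p else 0).
  rewrite /star_path -[LHS]mulrA; congr (_ * _).
  rewrite -(vs _ _ (valP p)) -[last _ _]/(ptail p) !mulrA vertex_vertex.
  rewrite (inj_eq (inv_inj (@phi0K Q))) eq_sym.
  by case: eqP => [<-|_]; rewrite ?mul0r.
case: eqP => e; last by rewrite mulr0.
by rewrite /star_path pcatE //= rev_cat big_cat /= mulrA.
Qed.

Definition nondegenerate_form (V : vectType F) (b : {biscalar V}) : Prop :=
  (forall v, (forall w, b v w = 0) -> v = 0) /\
  (forall w, (forall v, b v w = 0) -> w = 0).

(* [V] ranges over [vectType F], so finite dimensionality is built in. *)
Record eps_mixed (V : vectType F) (act : CQ -> V -> V)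
    (b : {biscalar V}) : Prop := EpsMixed {
  mixed_module : is_left_module act;
  mixed_nondegenerate : nondegenerate_form b;
  mixed_eps : forall v w, b v w = b w (act epsQ v);
  mixed_star : forall x v w, b (act x v) w = b v (act (star x) w)
}.

Definition eps_isomorphic (V V' : vectType F)
    (act : CQ -> V -> V) (b : {biscalar V})
    (act' : CQ -> V' -> V') (b' : {biscalar V'}) : Prop :=
  exists f : {linear V -> V'},
    [/\ bijective f,
        forall x v, f (act x v) = act' x (f v)
      & forall v w, b' (f v) (f w) = b v w].

End MixedModules.

(* [dim v] is the size of [gam v]; that it is invariant under phi is implicit
   in the equation relating [gam v] and [gam (phi0 v)], and is needed here to
   typecheck that equation. *)
Record supermixed_setting (F : fieldType) := SupermixedSetting {
  sms_quiver :> supermixed_quiver;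
  dim : Q0 sms_quiver -> nat;
  gam : forall v, 'M[F]_(dim v);
  dim_phi : forall v, dim (phi0 v) = dim v;
  gam_unit : forall v, gam v \in unitmx;
  gam_phi : forall v, gam v =
    (eps v)%:~R *: castmx (dim_phi v, dim_phi v) (gam (phi0 v))^T
}.

Arguments dim {F s} v.
Arguments gam {F s} v.

Section Setting.
Variables (F : fieldType) (G : supermixed_setting F).
Local Notation CQ := (path_algebra F G).

Definition Sgam : Type := {dffun forall v : Q0 G, 'M[F]_(dim v)}.

Definition Rep : Type :=
  {dffun forall a : Q1 G, 'M[F]_(dim (hd a), dim (tl a))}.

Definition starS (s : Sgam) : Sgam :=
  [ffun v => castmx (dim_phi v, dim_phi v)
    (invmx (gam (phi0 v)) *m (s (phi0 v))^T *m gam (phi0 v))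
    : 'M[F]_(dim v)].

(* The inner cast turns the size of m_(phi a)^T, dim t(phi a) x dim h(phi a),
   into dim phi(h a) x dim phi(t a). *)
Definition starR (m : Rep) : Rep :=
  [ffun a => (sgm a * eps (tl a))%:~R *:
    castmx (dim_phi (hd a), dim_phi (tl a))
      (invmx (gam (phi0 (hd a)))
       *m castmx (congr1 dim (tl_phi a), congr1 dim (hd_phi a)) (m (phi1 a))^T
       *m gam (phi0 (tl a)))
    : 'M[F]_(dim (hd a), dim (tl a))].

Definition DGL : set Sgam :=
  [set g : Sgam | forall v, g v *m starS g v = 1%:M]%classic.

Definition DRep : set Rep := [set m : Rep | starR m = m]%classic.

Definition gact (g : Sgam) (m : Rep) : Rep :=
  [ffun a => g (hd a) *m m a *m starS g (tl a)
    : 'M[F]_(dim (hd a), dim (tl a))].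

Definition same_orbit (m m' : Rep) : Prop :=
  exists2 g, DGL g & m' = gact g m.

(* The direct sum of the F^(dim v), in coordinates: the index set is the
   disjoint union of the 'I_(dim v). *)
Definition Fgam : vectType F := {ffun {v : Q0 G & 'I_(dim v)} -> F^o}.

Definition vcomp (v : Q0 G) (x : Fgam) : 'cV[F]_(dim v) :=
  \col_i x (Tagged (fun v => 'I_(dim v)) i).

Definition vinj (v : Q0 G) (y : 'cV[F]_(dim v)) : Fgam :=
  [ffun k => untag 0 (fun i : 'I_(dim v) => y i 0) k].

Lemma vinjK v : cancel (@vinj v) (vcomp v).
Proof.
move=> y; apply/matrixP => i j; rewrite !mxE ffunE untagE /=.
by rewrite /etagged /= (ord1 j).
Qed.

Lemma vcomp_vinj u v (y : 'cV[F]_(dim v)) : u != v -> vcomp u (vinj y) = 0.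
Proof. by move=> n; apply/matrixP => i j; rewrite !mxE ffunE untag_dflt. Qed.

Lemma vcomp_is_linear v : linear (vcomp v).
Proof. by move=> c x y; apply/matrixP => i j; rewrite !mxE !ffunE. Qed.

HB.instance Definition _ v :=
  GRing.isLinear.Build F Fgam 'cV[F]_(dim v) *:%R (vcomp v) (vcomp_is_linear v).

Lemma vinj_is_linear v : linear (@vinj v).
Proof.
move=> c x y; apply/ffunP => k; rewrite !ffunE.
have [e|n] := eqVneq (tag k) v; first by rewrite !(untagE _ _ e) !mxE.
by rewrite !untag_dflt // /GRing.scale /= mulr0 addr0.
Qed.

HB.instance Definition _ v :=
  GRing.isLinear.Build F 'cV[F]_(dim v) Fgam *:%R (@vinj v) (@vinj_is_linear v).

Lemma Fgam_ext (x y : Fgam) : (forall v, vcomp v x = vcomp v y) -> x = y.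
Proof.
move=> e; apply/ffunP => -[v i].
by move/matrixP/(_ i 0): (e v); rewrite !mxE.
Qed.

Definition vproj (v : Q0 G) (x : Fgam) : Fgam := vinj (vcomp v x).

Definition arrow_act (W : Rep) (a : Q1 G) (x : Fgam) : Fgam :=
  vinj (W a *m vcomp (tl a) x).

(* As for [star_path], a path with head v is v a_1 ... a_k. *)
Definition path_act (W : Rep) (p : qpath G) (x : Fgam) : Fgam :=
  vproj p.1 (foldr (arrow_act W) x p.2).

Definition rep_act (W : Rep) (y : CQ) (x : Fgam) : Fgam :=
  linext (fun p => path_act W p x) y.

Lemma arrow_act_is_linear W a : linear (arrow_act W a).
Proof.
by move=> c x y; rewrite /arrow_act linearP mulmxDr -scalemxAr linearP.
Qed.

HB.instance Definition _ W a := GRing.isLinear.Build F Fgam Fgam *:%R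
  (arrow_act W a) (arrow_act_is_linear W a).

Lemma path_act_is_linear W p : linear (path_act W p).
Proof.
move=> c x y; rewrite /path_act /vproj -!linearP; congr (vinj (vcomp _ _)).
by elim: p.2 => //= a s ->; rewrite linearP.
Qed.

HB.instance Definition _ W p := GRing.isLinear.Build F Fgam Fgam *:%R
  (path_act W p) (path_act_is_linear W p).

Lemma vcomp_vproj u v x :
  vcomp u (vproj v x) = if u == v then vcomp u x else 0.
Proof. by case: eqVneq => [->|n]; rewrite ?vinjK // vcomp_vinj. Qed.

Lemma path_act_vproj W p v x :
  path_act W p (vproj v x) = if ptail p == v then path_act W p x else 0.
Proof.
rewrite /path_act /ptail; case: (lastP p.2) => [|s a] /=.
  rewrite {1}/vproj vcomp_vproj.
  by case: eqP => // _; rewrite linear0.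
rewrite map_rcons last_rcons !foldr_rcons.
have -> : arrow_act W a (vproj v x) = if tl a == v then arrow_act W a x else 0.
  by rewrite /arrow_act vcomp_vproj; case: eqP => // _; rewrite mulmx0 linear0.
case: eqP => // _.
suff -> : foldr (arrow_act W) 0 s = 0 by rewrite /vproj !linear0.
by elim: s => //= b s ->; rewrite linear0.
Qed.

Lemma rep_act_vertex W v x : rep_act W (vertex v) x = vproj v x.
Proof. by rewrite /rep_act linext_pbase. Qed.

Lemma rep_act_arrow W a x : rep_act W (arrow a) x = arrow_act W a x.
Proof. by rewrite /rep_act linext_pbase /path_act /= /vproj vinjK. Qed.

Lemma rep_act_module W : is_left_module (rep_act W).
Proof.
split=> [v c x y|x c v w|v|x y v].
- exact: linext_is_linear.
- apply: etrans (linext_fun_linear _ _ _ _).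
  by apply: eq_bigr => p _; rewrite linearP.
- apply: Fgam_ext => u; rewrite /rep_act (linear_sum (linext _)) linear_sum.
  rewrite (bigD1 u) //= big1 => [|w nw]; rewrite -/(rep_act _ _ _).
    by rewrite addr0 rep_act_vertex vcomp_vproj eqxx.
  by rewrite rep_act_vertex vcomp_vproj eq_sym (negPf nw).
- rewrite paE; move: x; apply: pa_linearP => [c x x'|c x x'|p].
  + by rewrite pamul_linl; exact: linext_is_linear.
  + exact: linext_is_linear.
  rewrite [RHS]linext_pbase; move: y; apply: pa_linearP => [c y y'|c y y'|q].
  + by rewrite pamul_linr; exact: linext_is_linear.
  + by rewrite /rep_act linext_is_linear linearP.
  rewrite pamulUU /pmul /rep_act [in RHS]linext_pbase.
  rewrite [X in path_act W p X]/path_act path_act_vproj.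
  rewrite -[(pval q).1]/(phead q).
  case: eqP => e; last by rewrite linear0.
  by rewrite linext_pbase /path_act pcatE //= foldr_cat.
Qed.

Definition gform_fun (x y : Fgam) : F :=
  \sum_v ((vcomp v x)^T *m gam v
          *m castmx (dim_phi v, erefl 1%N) (vcomp (phi0 v) y)) 0 0.

Lemma gform_is_bilinear :
  bilinear_for (GRing.Scale.Law.clone _ _ *%R _)
    (GRing.Scale.Law.clone _ _ *%R _) gform_fun.
Proof.
split=> [x c y y' | x c y y']; rewrite /gform_fun /= mulr_sumr -big_split /=.
  apply: eq_bigr => v _.
  by rewrite linearP /= linearP /= !mulmxDl -!scalemxAl !mxE.
apply: eq_bigr => v _; rewrite linearP /=.
have -> : castmx (dim_phi v, erefl 1%N)
    (c *: vcomp (phi0 v) y + vcomp (phi0 v) y') =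
    c *: castmx (dim_phi v, erefl 1%N) (vcomp (phi0 v) y)
    + castmx (dim_phi v, erefl 1%N) (vcomp (phi0 v) y').
  by apply/matrixP => i j; rewrite !(castmxE, mxE).
by rewrite mulmxDr -scalemxAr !mxE.
Qed.

HB.instance Definition _ :=
  bilinear_isBilinear.Build F Fgam Fgam F
    (GRing.Scale.Law.clone _ _ *%R _) (GRing.Scale.Law.clone _ _ *%R _)
    gform_fun gform_is_bilinear.

Definition gform : {biscalar Fgam} := gform_fun.

Definition mixed_structures : set (CQ -> Fgam -> Fgam) :=
  [set act | (forall v x, act (vertex v) x = vproj v x)
             /\ eps_mixed act gform]%classic.

End Setting.

Arguments DGL {F} G.
Arguments DRep {F} G.
Arguments gform {F} G.
Arguments mixed_structures {F} G.

(* Main.v *)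
(* Tested on vectors concentrated at single vertices, the relation
   <a x, y> = <x, a^* y> for an arrow a says exactly that W is fixed by the
   involution at a; for vertices it always holds, and both sides are compatible
   with products, so it extends from the generators to the whole path algebra.
   A module structure in which the vertices act as the projections is determined
   by the blocks of its arrows. A module isomorphism commutes with the vertex
   projections, hence is block diagonal with blocks g_v; it preserves the form
   iff g g^* = 1, and it intertwines the arrows iff W' = g W g^*. *)
Require Import Defs.
From HB Require Import structures.
From mathcomp Require Import all_boot all_algebra.
From mathcomp Require Import finmap.
From mathcomp.multinomials Require Import monalg.
From mathcomp Require Import boolp.
From mathcomp Require Import classical_sets functions reals complex.

Set Implicit Arguments.
Unset Strict Implicit.
Unset Printing Implicit Defensive.

Import GRing.Theory.

Local Open Scope ring_scope.

(** * Induction on elements of the path algebra *)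

Section PathAlgebraInduction.
Variables (F : fieldType) (Q : quiver).
Local Notation CQ := (path_algebra F Q).

Lemma pbase_cons v (a : Q1 Q) s (c : composable v (a :: s))
    (c' : composable (tl a) s) :
  pbase F (@QPath Q (v, a :: s) c) =
  arrow a * pbase F (@QPath Q (tl a, s) c').
Proof.
rewrite paE pamulUU /pmul [ptail _]/= [phead _]/= eqxx.
have /andP[/eqP e _] := c.
by congr (pbase _ _); apply: val_inj; rewrite /= pcatE //= e.
Qed.

(** Peeling off leading arrows writes each path as a product of arrows and a final vertex, and paths
    span. Identities thus need checking on generators only. *)
Lemma path_algebra_ind (P : CQ -> Prop) :
  P 0 -> (forall c x y, P x -> P y -> P (c *: x + y)) ->
  (forall x y, P x -> P y -> P (x * y)) ->
  (forall v, P (vertex v)) -> (forall a, P (arrow a)) -> forall x, P x.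
Proof.
move=> P0 PL PM Pv Pa.
have Pp p : P (pbase F p).
  case: p => -[v s]; elim: s v => [|a s IH] v c.
    by have := Pv v; rewrite /vertex; congr (P (pbase _ _)); exact: val_inj.
  have /andP[_ c'] := c.
  by rewrite (pbase_cons c c'); apply: PM.
move=> x; pose y : CQ := \sum_(p <- msupp x) x@_p *: pbase F p.
have -> : x = y.
  rewrite /y; pose f := linext (fun p => pbase F p : CQ).
  rewrite -[RHS]/(f x); apply: (@pa_linearP F Q CQ id f) => // [|p].
    exact: linext_is_linear.
  by rewrite /f linext_pbase.
rewrite /y; elim/big_rec: _ => // p z _ Pz; exact: PL.
Qed.

End PathAlgebraInduction.

(** * Bilinear forms between spaces whose sizes agree up to a cast *)

Section Forms.
Variable F : fieldType.

Lemma mx_form_ext m n (A B : 'M[F]_(m, n)) :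
  (forall (x : 'cV_m) (y : 'cV_n),
    (x^T *m A *m y) 0 0 = (x^T *m B *m y) 0 0) -> A = B.
Proof.
move=> e; apply/matrixP => i j.
have := e (delta_mx i 0) (delta_mx j 0).
by rewrite !trmx_delta -!rowE -!colE !mxE.
Qed.

Lemma mx_ext_col m n (A B : 'M[F]_(m, n)) :
  (forall x : 'cV_n, A *m x = B *m x) -> A = B.
Proof.
move=> e; apply/matrixP => i j.
by move/matrixP/(_ i 0): (e (delta_mx j 0)); rewrite -!colE !mxE.
Qed.

Definition colmx m n (f : 'cV[F]_n -> 'cV[F]_m) : 'M[F]_(m, n) :=
  \matrix_(i, j) f (delta_mx j 0) i 0.

Lemma colmxE m n (f : 'cV[F]_n -> 'cV[F]_m) x : linear f -> colmx f *m x = f x.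
Proof.
move=> linf; pose f' : {linear 'cV[F]_n -> 'cV[F]_m} :=
  HB.pack f (GRing.isLinear.Build F _ _ _ f linf).
rewrite [in RHS](matrix_sum_delta x) -[f]/(f' : _ -> _) linear_sum.
apply/matrixP => i k; rewrite (ord1 k) summxE mxE; apply: eq_bigr => j _.
by rewrite big_ord1 linearZ !mxE mulrC.
Qed.

(* Sizes such as [dim (phi0 v)] and [dim v], which are only provably equal, are
   taken as independent variables here, so that the casts can be eliminated. *)
Definition bform n n' (e : n' = n) (g : 'M[F]_n) (x : 'cV_n) (y : 'cV_n') : F :=
  (x^T *m g *m castmx (e, erefl 1%N) y) 0 0.

(** Here [A] and [A'] are the blocks at an arrow and at its image under [phi1]. Without casts, both
    sides of the adjunction are [sh] times forms with matrices [(gh' *m A)^T] and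
    [((c * st) *: (A'^T *m gt'))^T]; cancelling [sh] and then [gh'] gives the formula. *)
Lemma bform_adjointP h t h' t' h'' t'' (eh : h' = h) (et : t' = t)
    (ch : t'' = h') (ct : h'' = t') (A : 'M[F]_(h, t)) (A' : 'M_(h'', t''))
    (gh : 'M_h) (gh' : 'M_h') (gt : 'M_t) (gt' : 'M_t') (sh st c : F) :
  sh * sh = 1 -> gh = sh *: castmx (eh, eh) gh'^T ->
  gt = st *: castmx (et, et) gt'^T -> gh' \in unitmx ->
  (forall x y, bform eh gh (A *m x) y = c * sh *
     bform et gt x (castmx (ct, erefl 1%N)
       (A' *m castmx (esym ch, erefl 1%N) y))) <->
  (c * st) *: castmx (eh, et)
     (invmx gh' *m castmx (ch, ct) A'^T *m gt') = A.
Proof.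
case: h / eh A gh => A gh; case: t / et A gt => A gt.
case: h' / ch gh' A gh => gh' A gh; case: t' / ct gt' gt A => gt' gt A.
rewrite !castmx_id => sh2 -> -> u.
have shN0 : sh != 0.
  by apply: contra_eq_neq sh2 => ->; rewrite mul0r eq_sym oner_eq0.
have key : gh' *m A = (c * st) *: (A'^T *m gt') <->
  (c * st) *: (invmx gh' *m A'^T *m gt') = A.
  split=> [e|<-]; first by rewrite -mulmxA scalemxAr -e mulKmx.
  by rewrite -scalemxAr -mulmxA mulKVmx.
have sE (a : F) (M : 'M_1) : (a *: M) 0 0 = a * M 0 0 by rewrite mxE.
have lhsE x y : bform erefl (sh *: gh'^T) (A *m x) y =
    sh * (x^T *m (gh' *m A)^T *m y) 0 0.
  by rewrite /bform castmx_id -scalemxAr -scalemxAl sE !trmx_mul !mulmxA.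
have rhsE x y : c * sh * bform erefl (st *: gt'^T) x
      (castmx (erefl, erefl) (A' *m castmx (esym erefl, erefl) y)) =
    sh * (x^T *m ((c * st) *: (A'^T *m gt'))^T *m y) 0 0.
  rewrite /bform !castmx_id [in RHS]linearZ /= trmx_mul trmxK.
  by rewrite -!(scalemxAr, scalemxAl) !sE !mulmxA !mulrA [sh * c]mulrC.
split=> [e|/key e x y]; last by rewrite lhsE rhsE e.
apply/key/trmx_inj/mx_form_ext => x y.
by apply: (mulfI shN0); rewrite -lhsE -rhsE.
Qed.

(** For the blocks at a vertex and at its image under [phi0], both conditions amount to
    [A'^T *m g' *m A = g']. Since the matrices are square, one-sided inverses are two-sided. *)
Lemma bform_isometryP n n' (e : n' = n) (g : 'M[F]_n) (g' : 'M_n')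
    (A : 'M_n) (A' : 'M_n') (s : F) :
  s * s = 1 -> g = s *: castmx (e, e) g'^T -> g' \in unitmx ->
  (forall x y, bform e g (A *m x) (A' *m y) = bform e g x y) <->
  A *m castmx (e, e) (invmx g' *m A'^T *m g') = 1%:M.
Proof.
case: n / e g A => g A; rewrite castmx_id => s2 -> u.
have sN0 : s != 0.
  by apply: contra_eq_neq s2 => ->; rewrite mul0r eq_sym oner_eq0.
have key : (A'^T *m g' *m A = g') <->
  A *m castmx (erefl, erefl) (invmx g' *m A'^T *m g') = 1%:M.
  rewrite castmx_id; split=> [e|/mulmx1C e].
    by apply: mulmx1C; rewrite -!mulmxA [_ *m (_ *m A)]mulmxA e mulVmx.
  by rewrite -[RHS]mulmx1 -e !mulmxA mulmxV // mul1mx.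
have sE (a : F) (M : 'M_1) : (a *: M) 0 0 = a * M 0 0 by rewrite mxE.
have formE x y : bform erefl (s *: g'^T) x y = s * (x^T *m g'^T *m y) 0 0.
  by rewrite /bform castmx_id -scalemxAr -scalemxAl sE.
have imE x y : bform erefl (s *: g'^T) (A *m x) (A' *m y) =
    s * (x^T *m (A'^T *m g' *m A)^T *m y) 0 0.
  by rewrite formE !trmx_mul trmxK !mulmxA.
split=> [e|/key e x y]; last by rewrite imE e formE.
apply/key/trmx_inj/mx_form_ext => x y.
by apply: (mulfI sN0); rewrite -imE -formE.
Qed.

Lemma bform_sym n n' (e : n' = n) (e' : n = n') (g : 'M[F]_n) (g' : 'M_n')
    (s : F) x y :
  g = s *: castmx (e, e) g'^T -> bform e g x y = s * bform e' g' y x.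
Proof.
case: n / e e' g x => e' g x -> ; rewrite /bform !castmx_id.
rewrite -scalemxAr -scalemxAl [LHS]mxE; congr (_ * _).
have -> : x^T *m g'^T *m y = (y^T *m g' *m x)^T.
  by rewrite !trmx_mul trmxK mulmxA.
by rewrite mxE.
Qed.

Lemma bform0l n n' (e : n' = n) (g : 'M[F]_n) y : bform e g 0 y = 0.
Proof. by rewrite /bform trmx0 !mul0mx mxE. Qed.

Lemma bform0r n n' (e : n' = n) (g : 'M[F]_n) x : bform e g x 0 = 0.
Proof. by case: n / e g x => g x; rewrite /bform castmx_id mulmx0 mxE. Qed.

Lemma bformZr n n' (e : n' = n) (g : 'M[F]_n) x c y :
  bform e g x (c *: y) = c * bform e g x y.
Proof. by case: n / e g x => g x; rewrite /bform !castmx_id -scalemxAr mxE. Qed.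

Lemma bform_castmxr n n' n'' (e : n' = n) (e' : n'' = n') (g : 'M[F]_n) x y :
  bform e g x (castmx (e', erefl 1%N) y) = bform (etrans e' e) g x y.
Proof. by case: n / e g x => g x; rewrite /bform castmx_comp. Qed.

Lemma bform_nondegl n n' (e : n' = n) (g : 'M[F]_n) x :
  g \in unitmx -> (forall y, bform e g x y = 0) -> x = 0.
Proof.
case: n / e g x => g x u e.
apply: trmx_inj; rewrite -[LHS](mulmxK u) trmx0.
suff -> : x^T *m g = 0 by rewrite mul0mx.
apply: trmx_inj; apply: trmx_inj; rewrite trmxK.
apply/matrixP=> i j; have := e (delta_mx j 0).
by rewrite /bform castmx_id -colE !mxE (ord1 i).
Qed.

End Forms.

(** * The form on [Fgam] and its adjunction relations *)

Section MixedStructures.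
Variables (F : fieldType) (G : supermixed_setting F).
Implicit Types (W : Rep G) (x y : Fgam G).

Local Notation dim := Defs.dim.
Local Notation epsF v := ((eps v)%:~R : F).

Lemma eps_sq (v : Q0 G) : epsF v * epsF v = 1.
Proof. by rewrite -intrM; case: (eps_sign v) => ->. Qed.

Lemma gformE x y : gform G x y =
  \sum_v bform (dim_phi v) (gam v) (vcomp v x) (vcomp (phi0 v) y).
Proof. by []. Qed.

Lemma gform_vinjl u (z : 'cV_(dim u)) y :
  gform G (vinj z) y = bform (dim_phi u) (gam u) z (vcomp (phi0 u) y).
Proof.
rewrite gformE (bigD1 u) //= big1 ?addr0 ?vinjK // => v nv.
by rewrite vcomp_vinj // bform0l.
Qed.

Lemma gform_vinjr u x (z : 'cV_(dim (phi0 u))) :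
  gform G x (vinj z) = bform (dim_phi u) (gam u) (vcomp u x) z.
Proof.
rewrite gformE (bigD1 u) //= big1 ?addr0 ?vinjK // => v nv.
by rewrite vcomp_vinj ?bform0r // (inj_eq (inv_inj (@phi0K G))).
Qed.

(** Vertices such as [hd (phi1 a)] and [phi0 (tl a)] are equal only by a proof; this moves a vector
    from one to the other. *)
Lemma vinj_castmx u v (e : u = v) (z : 'cV[F]_(dim u)) :
  vinj z = vinj (castmx (congr1 (@dim F G) e, erefl 1%N) z).
Proof. by case: v / e; rewrite castmx_id. Qed.

Lemma vcomp_castmx u v (e : u = v) x :
  vcomp u x = castmx (esym (congr1 (@dim F G) e), erefl 1%N) (vcomp v x).
Proof. by case: v / e; rewrite castmx_id. Qed.

Lemma gform_vproj v x y : gform G (vproj v x) y = gform G x (vproj (phi0 v) y).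
Proof. by rewrite gform_vinjl gform_vinjr. Qed.

Lemma gform_arrowl W a x y : gform G (arrow_act W a x) y =
  bform (dim_phi (hd a)) (gam (hd a)) (W a *m vcomp (tl a) x)
    (vcomp (phi0 (hd a)) y).
Proof. exact: gform_vinjl. Qed.

(** The casts are arranged as in the hypothesis of [bform_adjointP]. *)
Lemma gform_arrowr W a x y : gform G x (arrow_act W (phi1 a) y) =
  bform (dim_phi (tl a)) (gam (tl a)) (vcomp (tl a) x)
    (castmx (congr1 (@dim F G) (hd_phi a), erefl 1%N)
      (W (phi1 a) *m castmx (esym (congr1 (@dim F G) (tl_phi a)), erefl 1%N)
        (vcomp (phi0 (hd a)) y))).
Proof.
by rewrite /arrow_act (vinj_castmx (hd_phi a)) gform_vinjr
  (vcomp_castmx (tl_phi a)).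
Qed.

(** The sign [eps (hd a)] is absorbed when [gam_phi] rewrites [gam (hd a)]; rewriting [gam (tl a)]
    produces the [eps (tl a)] of [starR]. *)
Lemma DRepP W : DRep G W <->
  forall a x y, gform G (arrow_act W a x) y =
    (sgm a * eps (hd a))%:~R * gform G x (arrow_act W (phi1 a) y).
Proof.
have adjP a := @bform_adjointP F _ _ _ _ _ _ (dim_phi (hd a)) (dim_phi (tl a))
  (congr1 dim (tl_phi a)) (congr1 dim (hd_phi a)) (W a) (W (phi1 a))
  _ _ _ _ (epsF (hd a)) (epsF (tl a)) (sgm a)%:~R (eps_sq _)
  (gam_phi _) (gam_phi _) (gam_unit _).
split=> [DW a x y|adj].
  rewrite gform_arrowl gform_arrowr intrM; apply/(adjP a).2.
  by rewrite -intrM -[in RHS]DW /starR ffunE.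
apply/ffunP => a; rewrite ffunE intrM; apply/(adjP a).1 => x y.
have := adj a (vinj x) (vinj y); rewrite gform_arrowl gform_arrowr.
by rewrite !vinjK intrM.
Qed.

Lemma rep_act_epsQ W x v :
  vcomp v (rep_act W (epsQ F G) x) = epsF v *: vcomp v x.
Proof.
rewrite /epsQ /rep_act (linear_sum (linext _)) linear_sum (bigD1 v) //=.
rewrite big1 => [|u nu].
  rewrite linearZ linearZ /= -/(rep_act W _ _) rep_act_vertex vcomp_vproj.
  by rewrite eqxx addr0.
rewrite linearZ linearZ /= -/(rep_act W _ _) rep_act_vertex vcomp_vproj.
by rewrite eq_sym (negPf nu) scaler0.
Qed.

(** Reindexing one sum by [phi0] pairs the summands at [v] and [phi0 v], which [gam_phi] relates by
    transposition and the sign [eps v]. *)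
Lemma gform_eps W x y : gform G x y = gform G y (rep_act W (epsQ F G) x).
Proof.
rewrite !gformE [RHS](reindex_inj (inv_inj (@phi0K G))) /=.
apply: eq_bigr => v _; rewrite (vcomp_castmx (phi0K v)) rep_act_epsQ.
rewrite bform_castmxr bformZr; exact: bform_sym (gam_phi v).
Qed.

Lemma gform_nondegenerate : nondegenerate_form (gform G).
Proof.
have left0 x : (forall y, gform G x y = 0) -> x = 0.
  move=> x0; apply: Fgam_ext => v; rewrite linear0.
  apply: (bform_nondegl (e := dim_phi v) (gam_unit v)) => y.
  by rewrite -gform_vinjr x0.
split=> // y y0; apply: left0 => x.
(* [epsQ] involves vertices only, so any point of [Rep] serves to let it act. It acts as an
   involution, so [gform_eps] reduces the right kernel to the left one. *)
pose W : Rep G := [ffun a => 0 : 'M_(dim (hd a), dim (tl a))].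
have -> : x = rep_act W (epsQ F G) (rep_act W (epsQ F G) x).
  by apply: Fgam_ext => v; rewrite !rep_act_epsQ scalerA eps_sq scale1r.
by rewrite -gform_eps y0.
Qed.

Lemma rep_act_linearl W c z z' x :
  rep_act W (c *: z + z') x = c *: rep_act W z x + rep_act W z' x.
Proof. exact: linext_is_linear. Qed.

Lemma rep_act_star W : DRep G W ->
  forall z x y, gform G (rep_act W z x) y = gform G x (rep_act W (star z) y).
Proof.
move=> /DRepP DW; have modW := rep_act_module W.
apply: path_algebra_ind => [x y|c z z' IH IH' x y|z z' IH IH' x y|v x y|a x y].
- by rewrite /rep_act !linear0 linear0l.
- by rewrite linearP !rep_act_linearl linearPl linearPr /= IH IH'.
- by rewrite starM !(act_mul modW) IH IH'.
- by rewrite star_vertex !rep_act_vertex gform_vproj.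
- rewrite star_arrowE rep_act_arrow DW /star_arrow.
  rewrite [in RHS]/rep_act linearZ /= -/(rep_act _ _ _) rep_act_arrow.
  by rewrite linearZr.
Qed.

(** The module axioms, nondegeneracy and the [epsQ] symmetry hold at every point, so [mixed_star]
    carries the whole condition. *)
Lemma eps_mixed_rep_act W : eps_mixed (rep_act W) (gform G) <-> DRep G W.
Proof.
split=> [mixW|DW].
  apply/DRepP => a x y; rewrite -rep_act_arrow (mixed_star mixW).
  rewrite star_arrowE /star_arrow [in LHS]/rep_act linearZ /=.
  by rewrite -/(rep_act _ _ _) rep_act_arrow linearZr.
split; [exact: rep_act_module|exact: gform_nondegenerate|exact: gform_eps|].
exact: rep_act_star.
Qed.

(** * Module structures as points of [Rep] *)

Lemma rep_act_inj : injective (@rep_act F G).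
Proof.
move=> W W' e; apply/ffunP => a; apply: mx_ext_col => z.
have /(congr1 (vcomp (hd a))) : rep_act W (arrow a) (vinj z) =
  rep_act W' (arrow a) (vinj z) by rewrite e.
by rewrite !rep_act_arrow !vinjK.
Qed.

Lemma module_rep_act (act : path_algebra F G -> Fgam G -> Fgam G) :
  is_left_module act -> (forall v x, act (vertex v) x = vproj v x) ->
  exists W, act = rep_act W.
Proof.
move=> modA vA.
pose W : Rep G :=
  [ffun a => colmx (fun z => vcomp (hd a) (act (arrow a) (vinj z)))].
exists W; have modW := rep_act_module W.
suff e z x : act z x = rep_act W z x by apply/funext => z; exact/funext.
move: z x; apply: path_algebra_ind =>
  [x|c z z' IH IH' x|z z' IH IH' x|v x|a x].
- have := act_linearl modA x (-1) 0 0.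
  by rewrite /= scaler0 addr0 scaleN1r addNr /rep_act linear0.
- by rewrite rep_act_linearl (act_linearl modA) IH IH'.
- by rewrite (act_mul modA) (act_mul modW) IH IH'.
- by rewrite vA rep_act_vertex.
(* As vertices act by projections, this factorization leaves only the block of [a] from tail to
   head, which is [W a]. *)
have aE : arrow a = vertex (hd a) * arrow a * vertex (tl a) :> path_algebra F G.
  by rewrite vertex_arrow eqxx arrow_vertex eqxx.
rewrite rep_act_arrow {1}aE !(act_mul modA) !vA /arrow_act /W ffunE colmxE //.
by move=> c z z'; rewrite linearP (act_linearr modA) linearP.
Qed.

(** * Block diagonal maps and orbits *)

Definition block (g : Sgam G) (x : Fgam G) : Fgam G :=
  [ffun k => (g (tag k) *m vcomp (tag k) x) (tagged k) 0].

Lemma vcomp_block g v x : vcomp v (block g x) = g v *m vcomp v x.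
Proof. by apply/matrixP => i j; rewrite [LHS]mxE ffunE (ord1 j). Qed.

Fact block_is_linear g : linear (block g).
Proof.
move=> c x y; apply: Fgam_ext => v.
by rewrite vcomp_block !linearP /= !vcomp_block.
Qed.

HB.instance Definition _ g := GRing.isLinear.Build F (Fgam G) (Fgam G) *:%R
  (block g) (block_is_linear g).

Lemma block_vinj g v (z : 'cV_(dim v)) : block g (vinj z) = vinj (g v *m z).
Proof.
apply: Fgam_ext => u; rewrite vcomp_block.
by have [->|n] := eqVneq u v; rewrite ?vinjK // !vcomp_vinj // mulmx0.
Qed.

Lemma DGLP (g : Sgam G) : DGL G g <->
  forall x y, gform G (block g x) (block g y) = gform G x y.
Proof.
have isoP v := bform_isometryP (g v) (g (phi0 v)) (eps_sq v) (gam_phi v)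
  (gam_unit (phi0 v)).
split=> [Dg x y|iso v].
  rewrite !gformE; apply: eq_bigr => v _; rewrite !vcomp_block.
  by apply/(isoP v).2; have := Dg v; rewrite /starS ffunE.
rewrite /starS ffunE; apply/(isoP v).1 => x y.
(* The vector [x] sits at [v] and [y] at [phi0 v], the one component that the form pairs with it. *)
have := iso (vinj x) (vinj y).
by rewrite !block_vinj !gform_vinjl !vinjK.
Qed.

Lemma block_bij g : DGL G g -> bijective (block g).
Proof.
move=> Dg; exists (block (starS g)) => x; apply: Fgam_ext => v;
  rewrite !vcomp_block mulmxA; last by rewrite Dg mul1mx.
by rewrite (mulmx1C (Dg v)) mul1mx.
Qed.

(** Block maps commute with the vertex projections, so arrows give the only conditions,
    [g (hd a) *m W a = W' a *m g (tl a)]; [starS g] inverts [g]. *)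
Lemma block_rep_actP g W W' : DGL G g ->
  (forall z x, block g (rep_act W z x) = rep_act W' z (block g x)) <->
  W' = gact g W.
Proof.
move=> Dg; have DgV v := mulmx1C (Dg v).
split=> [comm|->].
  apply/ffunP => a; rewrite ffunE.
  suff -> : g (hd a) *m W a = W' a *m g (tl a) by rewrite -mulmxA Dg mulmx1.
  apply: mx_ext_col => z.
  have := congr1 (vcomp (hd a)) (comm (arrow a) (vinj z)).
  by rewrite !rep_act_arrow block_vinj /arrow_act block_vinj !vinjK !mulmxA.
have modW := rep_act_module W; have modW' := rep_act_module (gact g W).
apply: path_algebra_ind => [x|c z z' IH IH' x|z z' IH IH' x|v x|a x].
- by rewrite /rep_act !linear0.
- by rewrite !rep_act_linearl linearP /= IH IH'.
- by rewrite (act_mul modW) (act_mul modW') IH IH'.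
- by rewrite !rep_act_vertex /vproj block_vinj vcomp_block.
rewrite !rep_act_arrow /arrow_act block_vinj vcomp_block ffunE.
by rewrite -!mulmxA [starS _ _ *m _]mulmxA DgV mul1mx.
Qed.

(** Commuting with the projection at [v] makes the component of [f x] at [v] depend only on that of
    [x]. *)
Lemma rep_act_morph_block (f : {linear Fgam G -> Fgam G}) W W' :
  (forall z x, f (rep_act W z x) = rep_act W' z (f x)) ->
  exists g, f =1 block g.
Proof.
move=> comm; exists [ffun v => colmx (fun z => vcomp v (f (vinj z)))] => x.
apply: Fgam_ext => v; rewrite vcomp_block ffunE colmxE.
  have := comm (vertex v) x; rewrite !rep_act_vertex => ->.
  by rewrite vinjK.
by move=> c z z'; rewrite !linearP.
Qed.

Lemma eps_isomorphic_orbit W W' :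
  eps_isomorphic (rep_act W) (gform G) (rep_act W') (gform G) <->
  same_orbit W W'.
Proof.
split=> [[f [_ comm iso]]|[g Dg W'E]].
  have [g fE] := rep_act_morph_block comm.
  have Dg : DGL G g by apply/DGLP => x y; rewrite -!fE iso.
  by exists g => //; apply/(block_rep_actP _ _ Dg) => z x; rewrite -!fE.
exists (block g); split; first exact: block_bij.
  exact/block_rep_actP.
exact/DGLP.
Qed.

Lemma rep_act_bij : set_bij (DRep G) (mixed_structures G) (@rep_act F G).
Proof.
split=> [W DW|W W' _ _|act [vA mixA]]; last 2 first.
- exact: rep_act_inj.
- have [W e] := module_rep_act (mixed_module mixA) vA.
  by exists W => //; apply/eps_mixed_rep_act; rewrite -e.
by split=> [v x|]; [exact: rep_act_vertex|exact/eps_mixed_rep_act].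
Qed.

End MixedStructures.

Local Open Scope complex_scope.

Theorem theorem4p1 (R : realType) (G : supermixed_setting R[i]) :
  set_bij (DRep G) (mixed_structures G) (@rep_act _ G) /\
  (forall W W' : Rep G, DRep G W -> DRep G W' ->
     eps_isomorphic (rep_act W) (gform G) (rep_act W') (gform G)
     <-> same_orbit W W').
Proof.
split=> [|W W' _ _]; [exact: rep_act_bij|exact: eps_isomorphic_orbit].
Qed.
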